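(* For every $k \geq 1$ and every nonzero subspace $U \leq \mathrm{Sym}^k \mathbf{C}^3$, $$\mathrm{diam}_+^{\mathrm{SL}_3(\mathbf{C})}\bigl(\mathrm{Sym}^k \mathbf{C}^3, U\bigr) \leq 9\ln 3 \cdot \frac{\dim \mathrm{Sym}^k \mathbf{C}^3}{\dim U} + 9,$$ and, for the action of $\mathrm{SL}_3(\mathbf{C})$, $\mathsf{C}(\mathrm{Sym}^k \mathbf{C}^3) < 16$.
   Context: $\mathrm{SL}_3(\mathbf{C})$ acts on $\mathrm{Sym}^k \mathbf{C}^3$ through its natural action on $\mathbf{C}^3$. For a group $H$ acting linearly on a finite-dimensional complex vector space $V$ and a nonzero subspace $U \leq V$, the group-additive diameter is $$\mathrm{diam}_+^{H}(V,U) = \min\{ m \mid g_1\cdot U + \dots + g_m\cdot U = V \text{ for some } g_1,\dots,g_m \in H\}.$$ If $H$ acts irreducibly on $V$, put $\mathsf{R}(V,U) = \mathrm{diam}_+^{H}(V,U) / \lceil \dim V/\dim U\rceil$, and the covering complexity of $V$ (with respect to $H$) is $\mathsf{C}(V) = \max_{0 \neq U \leq V} \mathsf{R}(V,U)$. *)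

(* Defs.v *)
From HB Require Import structures.
From mathcomp Require Import all_boot all_order all_algebra.
From mathcomp Require Import mpoly.

Set Implicit Arguments.
Unset Strict Implicit.
Unset Printing Implicit Defensive.

Import Order.TTheory GRing.Theory Num.Theory.
Local Open Scope ring_scope.

Record linear_action (F : fieldType) (H : groupType) (V : vectType F) :=
  LinearAction {
    action_fun :> H -> 'End(V);
    action1 : action_fun 1%g = \1%VF;
    actionM : forall g h : H,
      action_fun (g * h)%g = (action_fun g \o action_fun h)%VF }.

Section CoveringComplexity.
Variables (F : fieldType) (H : groupType) (V : vectType F).
Variable act : linear_action H V.

Definition irreducible_action : Prop :=
  {:V}%VS <> 0%VS /\
  forall W : {vspace V},
    (forall g : H, (act g @: W <= W)%VS) -> W = 0%VS \/ W = {:V}%VS.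

Definition covered_by_translates (U : {vspace V}) (m : nat) : Prop :=
  exists g : 'I_m -> H, (\sum_(i < m) (act (g i) @: U))%VS = {:V}%VS.

(* The minimum and the maximum below are relations ("m is the minimum",
   "c is the maximum"), so that no default value is given to the minimum of an
   empty set or to a maximum that is not attained. *)
Definition is_group_additive_diameter (U : {vspace V}) (m : nat) : Prop :=
  covered_by_translates U m /\
  forall m' : nat, covered_by_translates U m' -> (m <= m')%N.

Definition is_covering_ratio (U : {vspace V}) (r : rat) : Prop :=
  exists2 m : nat, is_group_additive_diameter U m &
    r = m%:R / (Num.ceil ((\dim {:V})%:R / (\dim U)%:R : rat))%:~R.

Definition is_covering_complexity (c : rat) : Prop :=
  [/\ irreducible_action,
      exists2 U : {vspace V}, U <> 0%VS & is_covering_ratio U c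
    & forall (U : {vspace V}) (r : rat),
        U <> 0%VS -> is_covering_ratio U r -> r <= c].

End CoveringComplexity.

Section SpecialLinearGroup.
Variables (F : fieldType) (n : nat).

Definition SL := {g : 'M[F]_n | \det g == 1}.

HB.instance Definition _ := Choice.on SL.

Implicit Types g h : SL.

Lemma SL_det g : \det (val g) = 1.
Proof. exact/eqP/(valP g). Qed.

Lemma SL_unit g : val g \in unitmx.
Proof. by rewrite unitmxE SL_det unitr1. Qed.

Fact SL_one_subproof : \det (1%:M : 'M[F]_n) == 1.
Proof. by rewrite det1. Qed.

Fact SL_mul_subproof g h : \det (val g *m val h) == 1.
Proof. by rewrite det_mulmx !SL_det mulr1. Qed.

Fact SL_inv_subproof g : \det (invmx (val g)) == 1.
Proof. by rewrite det_inv SL_det invr1. Qed.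

Definition SL_one : SL := exist _ 1%:M SL_one_subproof.
Definition SL_mul g h : SL := exist _ (val g *m val h) (SL_mul_subproof g h).
Definition SL_inv g : SL := exist _ (invmx (val g)) (SL_inv_subproof g).

Fact SL_mulA : associative SL_mul.
Proof. by move=> x y z; apply: val_inj; rewrite /= mulmxA. Qed.
Fact SL_mul1 : left_id SL_one SL_mul.
Proof. by move=> x; apply: val_inj; rewrite /= mul1mx. Qed.
Fact SL_1mul : right_id SL_one SL_mul.
Proof. by move=> x; apply: val_inj; rewrite /= mulmx1. Qed.
Fact SL_mulV : left_inverse SL_one SL_inv SL_mul.
Proof. by move=> x; apply: val_inj; rewrite /= mulVmx // SL_unit. Qed.
Fact SL_Vmul : right_inverse SL_one SL_inv SL_mul.
Proof. by move=> x; apply: val_inj; rewrite /= mulmxV // SL_unit. Qed.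

HB.instance Definition _ :=
  isGroup.Build SL SL_mulA SL_mul1 SL_1mul SL_mulV SL_Vmul.

End SpecialLinearGroup.

Section SymmetricPower.
Variables (F : fieldType) (n k : nat).

(* Sym F n k is Sym^k of F^(n+1) (so C^3 is n = 2), the basis vector e_i being
   written 'X_i: the degree k part of the symmetric algebra F['X_0, ..., 'X_n].
   The vectType instance on dhomog exists only for a successor number of
   variables, hence the shift. *)
Definition Sym : vectType F := dhomog n.+1 F k.

(* The image of e_j under g: the vector whose coordinates are column j of g. *)
Definition basis_image (g : 'M[F]_n.+1) : n.+1.-tuple {mpoly F[n.+1]} :=
  [tuple \sum_i g i j *: 'X_i | j < n.+1].

Fact Sym_subst_homog (g : 'M[F]_n.+1) (p : {mpoly F[n.+1]}) :
  p \is k.-homog -> p \mPo basis_image g \is k.-homog.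
Proof.
move=> /dhomogP hp; rewrite comp_mpolyEX big_seq.
apply: rpred_sum => m /hp dm; apply: rpredZ; rewrite comp_mpolyX.
have -> : k = (\sum_(i < n.+1) m i)%N by rewrite -mdegE.
apply: (big_ind2 (fun (q : {mpoly F[n.+1]}) d => q \is d.-homog)).
- exact: dhomog1.
- by move=> q1 d1 q2 d2; apply: dhomogM.
move=> i _; rewrite -[X in X.-homog]mul1n; apply: dhomogMn.
rewrite tnth_mktuple; apply: rpred_sum => l _; apply: rpredZ.
by rewrite dhomogX /= mdeg1.
Qed.

Definition Sym_subst (g : 'M[F]_n.+1) (p : Sym) : Sym :=
  DHomog (Sym_subst_homog g (dhomog_is_dhomog p)).

Fact Sym_subst_is_linear g : linear (Sym_subst g).
Proof. by move=> c p q; apply: val_inj; rewrite /= linearP. Qed.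

HB.instance Definition _ g :=
  GRing.isLinear.Build F Sym Sym _ (Sym_subst g) (Sym_subst_is_linear g).

Definition Sym_fun (g : SL F n.+1) : 'End(Sym) := linfun (Sym_subst (val g)).

Fact Sym_fun1 : Sym_fun 1%g = \1%VF.
Proof.
apply/lfunP => p; rewrite lfunE id_lfunE; apply: val_inj => /=.
rewrite -[RHS]comp_mpoly_id; congr (_ \mPo _).
apply: eq_from_tnth => j; rewrite !tnth_mktuple (bigD1 j) //= mxE eqxx scale1r.
by rewrite big1 ?addr0 // => i /negPf ij; rewrite mxE ij scale0r.
Qed.

Fact Sym_funM g h : Sym_fun (g * h)%g = (Sym_fun g \o Sym_fun h)%VF.
Proof.
apply/lfunP => p; rewrite comp_lfunE !lfunE; apply: val_inj => /=.
rewrite [X in _ = X \mPo _]comp_mpolyE [LHS]comp_mpolyE [RHS]raddf_sum /=.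
apply: eq_bigr => m _; rewrite linearZ rmorph_prod /=; congr (_ *: _).
apply: eq_bigr => j _; rewrite rmorphXn /=; congr (_ ^+ _).
rewrite !tnth_mktuple raddf_sum /=.
under [RHS]eq_bigr => l _.
  rewrite linearZ /= comp_mpolyXU -tnth_nth tnth_mktuple scaler_sumr; over.
rewrite exchange_big /=; apply: eq_bigr => i _.
rewrite mxE scaler_suml; apply: eq_bigr => l _.
by rewrite scalerA mulrC.
Qed.

Definition Sym_action : linear_action (SL F n.+1) Sym :=
  LinearAction Sym_fun1 Sym_funM.

End SymmetricPower.

(* Main.v *)
From HB Require Import structures.
From mathcomp Require Import perm.
Require Import Defs.
From mathcomp Require Import all_boot all_order all_algebra.
From mathcomp Require Import reals complex boolp.
From mathcomp Require exp.
From mathcomp Require Import mpoly zify ring lra.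

Set Implicit Arguments.
Unset Strict Implicit.
Unset Printing Implicit Defensive.

Import Order.TTheory GRing.Theory Num.Theory.
Local Open Scope ring_scope.

(** Let V be the space of ternary forms of degree k, N its dimension and d that of
    U. The proof gives a diameter of at most 6 N / d + 3. This is below
    9 ln 3 * N / d + 9 because ln 3 >= 2 / 3, and it bounds every covering ratio
    by 9. It has two halves.

    Few translates of U fill more than two thirds of V. For a subspace X of an
    irreducible representation of a connected group, let phi(X) be the dimension
    of the meet of X with a general translate of U. This function is invariant
    and supermodular, so the subspaces where N phi(X) - d dim X is maximal are
    closed under sums, and the largest is stable, hence 0 or V. Thus
    phi(X) <= d dim X / N (generic_meet_slope): a general translate of U fills
    the fraction d / N of what X leaves uncovered. While N / 3 is missing each
    translate gains d / 3, so floor (2 N / d) + 1 translates leave less than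
    N / 3 missing (translates_large).

    Three translates of a subspace W of codimension less than N / 3 cover V
    (three_translates). Choose a set A of at most codim W monomials that spans a
    supplement of some translate of W, of the largest total weight for a
    one-parameter torus whose weights separate the monomials. Then this translate
    degenerates along the torus to the span of the monomials outside A
    (torus_limit), and transvections show that the set T of these monomials is
    closed under replacing a variable by an earlier one (extremal_stable); T is
    what is known as the generic initial set of W. As spanning V is an open
    condition, it is enough that three elements of the group move the span of T
    over all of V (degeneration). Write a, b, c for the exponents. Three cyclic
    rotations of the region a <= k/3 <= c exhaust all monomials, so the region
    has at least N / 3 elements and A misses one of them. By the closure property
    T contains the opposite region c <= k/3 <= a, and three cyclic rotations of
    that region exhaust all monomials as well.

    The two halves multiply to 3 (floor (2 N / d) + 1) translates of U.
    Openness and degeneration are expressed by polynomial curves in V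
    (full_limit_generic): if the limit of a moving subspace is V, so is its
    general member. *)

(** * Translates in general position *)

Section LinearAction.
Variables (F : fieldType) (H : groupType) (V : vectType F).
Variable act : linear_action H V.
Implicit Types (g h : H) (U W X Y Z : {vspace V}).

Lemma actionMV g h W : (act (g * h)%g @: W = act g @: (act h @: W))%VS.
Proof. by rewrite actionM limg_comp. Qed.

Lemma actionVK g W : (act g^-1%g @: (act g @: W) = W)%VS.
Proof. by rewrite -actionMV mulVg action1 lim1g. Qed.

Lemma action_ker g : lker (act g) == 0%VS.
Proof.
apply/lker0P => u v uv.
have: act g^-1%g (act g u) = act g^-1%g (act g v) by rewrite uv.
by rewrite -!comp_lfunE -!actionM mulVg action1 !id_lfunE.
Qed.

Lemma dim_action g W : \dim (act g @: W) = \dim W.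
Proof. by apply: limg_dim_eq; rewrite (eqP (action_ker g)) capv0. Qed.

Lemma action_cap g X Y :
  (act g @: (X :&: Y) = (act g @: X) :&: (act g @: Y))%VS.
Proof.
have sub h A B : (act h @: (A :&: B) <= (act h @: A) :&: (act h @: B))%VS.
  by rewrite subv_cap !limgS ?capvSl ?capvSr.
apply/eqP; rewrite eqEsubv sub /=.
rewrite -[X in (X <= _)%VS](actionVK g^-1%g) invgK limgS //.
by rewrite (subv_trans (sub _ _ _)) // !actionVK.
Qed.

(** The trace left by the irreducibility of the group as a variety: each of the
    two conditions on g is open, and nonempty open sets meet. *)
Definition connected_action : Prop := forall U Y Z,
  (exists g, act g @: U + Y = fullv)%VS ->
  (exists g, act g @: U + Z = fullv)%VS ->
  exists g, (act g @: U + Y = fullv)%VS /\ (act g @: U + Z = fullv)%VS.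

Section GenericMeet.
Variable U : {vspace V}.

Fact generic_meet_subproof X :
  exists d, `[< exists g, \dim (X :&: act g @: U) = d >].
Proof.
by exists (\dim (X :&: act 1%g @: U)); apply/asboolP; exists 1%g.
Qed.

(** The dimension of the meet of X with a general translate of U: dimensions of
    meets are upper semicontinuous in g, so the general one is the least. *)
Definition generic_meet X : nat := ex_minn (generic_meet_subproof X).

Lemma generic_meet_le X g : (generic_meet X <= \dim (X :&: act g @: U))%N.
Proof.
by rewrite /generic_meet; case: ex_minnP => d _; apply; apply/asboolP; exists g.
Qed.

Lemma generic_meet_attained X :
  exists g, \dim (X :&: act g @: U) = generic_meet X.
Proof. by rewrite /generic_meet; case: ex_minnP => d /asboolP. Qed.

Lemma generic_meet_action X g : generic_meet (act g @: X) = generic_meet X.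
Proof.
have le h Y : (generic_meet (act h @: Y) <= generic_meet Y)%N.
  have [g' <-] := generic_meet_attained Y.
  by rewrite (leq_trans (generic_meet_le _ (h * g')%g)) // actionMV -action_cap
     dim_action.
apply/eqP; rewrite eqn_leq le -{1}(actionVK g X).
exact: le.
Qed.

Lemma generic_meet0 : generic_meet 0%VS = 0%N.
Proof.
by apply/eqP; rewrite -leqn0 (leq_trans (generic_meet_le _ 1%g)) // cap0v dimv0.
Qed.

Lemma generic_meet_full : generic_meet fullv = \dim U.
Proof. by have [g <-] := generic_meet_attained fullv; rewrite capfv dim_action. Qed.

Hypothesis conn : connected_action.

Lemma generic_meet_attained2 X Y : exists g,
  \dim (X :&: act g @: U) = generic_meet X /\
  \dim (Y :&: act g @: U) = generic_meet Y.
Proof.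
have full Z g : (act g @: U + (Z + (Z + act g @: U)^C) = fullv)%VS.
  by rewrite addvA [(_ + Z)%VS]addvC addv_complf.
(* Equality with fullv forces the sum, hence the meet, to have the dimension
   it has at g. *)
have meet Z g g' : \dim (Z :&: act g @: U) = generic_meet Z ->
    (act g' @: U + (Z + (Z + act g @: U)^C) = fullv)%VS ->
    \dim (Z :&: act g' @: U) = generic_meet Z.
  move=> eg eg'; apply/eqP; rewrite eqn_leq generic_meet_le andbT -eg.
  have := dimv_sum_cap Z (act g @: U); have := dimv_sum_cap Z (act g' @: U).
  have := dimv_compl (Z + act g @: U).
  have := (dimv_add_leqif (Z + act g' @: U)%VS (Z + act g @: U)^C%VS).1.
  rewrite [(Z + act g' @: U)%VS]addvC -addvA eg' !dim_action.
  have := dimvS (subvf (Z + act g @: U)).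
  rewrite dimvf [(act g' @: U + Z)%VS]addvC.
  by lia.
have [gX eX] := generic_meet_attained X.
have [gY eY] := generic_meet_attained Y.
have [g [egX egY]] := conn (ex_intro _ gX (full X gX)) (ex_intro _ gY (full Y gY)).
by exists g; rewrite (meet X gX) // (meet Y gY).
Qed.

(** An element g general for both X + Y and X :&: Y may be used; for that g the
    inequality holds because X :&: gU and Y :&: gU sum into (X + Y) :&: gU and
    meet in (X :&: Y) :&: gU. *)
Lemma generic_meet_supermodular X Y :
  (generic_meet X + generic_meet Y
     <= generic_meet (X + Y) + generic_meet (X :&: Y))%N.
Proof.
have [g [<- <-]] := generic_meet_attained2 (X + Y)%VS (X :&: Y)%VS.
apply: leq_trans (leq_add (generic_meet_le X g) (generic_meet_le Y g)) _.
rewrite -dimv_sum_cap leq_add ?dimvS //.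
  by rewrite subv_cap addvS ?capvSl // subv_add !capvSr.
by rewrite !subv_cap (subv_trans (capvSl _ _)) ?capvSl //=
   (subv_trans (capvSr _ _)) ?capvSl //= (subv_trans (capvSl _ _)) ?capvSr.
Qed.

End GenericMeet.

Lemma exists_maximum (T : Type) (f : T -> nat) (b : nat) (x0 : T) :
  (forall x, f x <= b)%N -> exists x, forall y, (f y <= f x)%N.
Proof.
move=> fb; pose P d := `[< exists x, f x = d >].
have exP : exists d, P d by exists (f x0); apply/asboolP; exists x0.
have bP d : P d -> (d <= b)%N by move=> /asboolP[x <-].
have [_ /asboolP[x <-] max_x] := ex_maxnP exP bP.
by exists x => y; apply: max_x; apply/asboolP; exists y.
Qed.

(** The bound asks that N phi(X) - d dim X be nonpositive, where phi is the
    generic meet. This difference is supermodular and invariant under the group,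
    so if M maximizes it, so does M + gM; hence an M that is maximal and of
    largest dimension is stable, and irreducibility leaves M = 0 or M = V, where
    the difference vanishes. *)
Lemma generic_meet_slope U X : irreducible_action act -> connected_action ->
  (\dim {:V} * generic_meet U X <= \dim U * \dim X)%N.
Proof.
move=> [_ irr] conn.
pose N : nat := \dim {:V}; pose d : nat := \dim U; rewrite -/N -/d.
have dN Y : (\dim Y <= N)%N by rewrite dimvS ?subvf.
have gN Y : (generic_meet U Y <= N)%N.
  by apply: leq_trans (generic_meet_le U Y 1%g) _.
(* The shift by N^2 keeps the difference in nat. In the quantity maximized next
   the factor N + 1 puts excess first and leaves dim to break ties. *)
pose excess Y := (N * generic_meet U Y + (N * N - d * \dim Y))%N.
have exb Y : (d * \dim Y <= N * N)%N by apply: leq_mul (dN U) (dN Y).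
have [M maxM] := @exists_maximum _ (fun Y => excess Y * N.+1 + \dim Y)%N
   ((N * N + N * N) * N.+1 + N)%N 0%VS
   (fun Y => leq_add (leq_mul (leq_add (leq_mul (leqnn N) (gN Y)) (leq_subr _ _))
                        (leqnn _)) (dN Y)).
have max_excess Y : (excess Y <= excess M)%N.
  have := maxM Y; have := dN Y; have := dN M; nia.
have max_dim Y : excess Y = excess M -> (\dim Y <= \dim M)%N.
  by move=> e; have := maxM Y; rewrite e leq_add2l.
have M_stable g : (act g @: M <= M)%VS.
  have : excess (M + act g @: M)%VS = excess M.
    apply/eqP; rewrite eqn_leq max_excess /=.
    have := max_excess (M :&: act g @: M)%VS.
    have := generic_meet_supermodular U conn M (act g @: M)%VS.
    have := dimv_sum_cap M (act g @: M)%VS.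
    rewrite /excess generic_meet_action dim_action.
    have := exb M; have := exb (M + act g @: M)%VS.
    have := exb (M :&: act g @: M)%VS.
    nia.
  move=> /max_dim dM; have /eqP eM : M == (M + act g @: M)%VS.
    by rewrite eqEdim addvSl dM.
  by rewrite [X in (_ <= X)%VS]eM addvSr.
have := max_excess X; have := exb X; rewrite /excess.
case: (irr M M_stable) => ->.
  by rewrite generic_meet0 dimv0; lia.
by have := exb fullv; rewrite generic_meet_full -/N -/d; lia.
Qed.

(** In dim (X + gU) = dim X + dim U - dim (X :&: gU) a general g makes the last
    term at most dim U dim X / dim V. *)
Lemma translate_gain U X : irreducible_action act -> connected_action ->
  exists g, (\dim {:V} * \dim X + \dim U * (\dim {:V} - \dim X)
               <= \dim {:V} * \dim (X + act g @: U))%N.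
Proof.
move=> irr conn; have := generic_meet_slope U X irr conn.
have [g <-] := generic_meet_attained U X => slope; exists g.
have := dimv_sum_cap X (act g @: U); have := dimvS (subvf X).
rewrite dim_action; set N := \dim {:V} in slope *; nia.
Qed.

Definition translates_sum (gs : seq H) U : {vspace V} :=
  (\sum_(g <- gs) act g @: U)%VS.

Lemma translates_sum_allpairs hs gs U :
  translates_sum [seq (h * g)%g | h <- hs, g <- gs] U =
  translates_sum hs (translates_sum gs U).
Proof.
rewrite /translates_sum; elim: hs => [|h hs IH]; first by rewrite !big_nil.
rewrite big_cons -IH [LHS]big_cat big_map limg_sum.
by congr (_ + _)%VS; apply: eq_bigr => g _; rewrite actionMV.
Qed.

Lemma translates_sumS gs U W :
  (U <= W)%VS -> (translates_sum gs U <= translates_sum gs W)%VS.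
Proof.
move=> UW; rewrite /translates_sum; elim: gs => [|g gs IH]; first by rewrite !big_nil.
by rewrite !big_cons addvS // limgS.
Qed.

Lemma covered_by_seq gs U :
  translates_sum gs U = fullv -> covered_by_translates act U (size gs).
Proof.
move=> full; exists (tnth (in_tuple gs)).
by rewrite -full /translates_sum -[gs in RHS]/(tval (in_tuple gs)) [RHS]big_tuple.
Qed.

(** As long as a third of V is missing, each further translate gains at least
    dim U / 3. *)
Lemma translates_large U j : irreducible_action act -> connected_action ->
  exists gs, size gs = j /\
    ((3 * (\dim {:V} - \dim (translates_sum gs U)) < \dim {:V})%N \/
     (\dim U * j <= 3 * \dim (translates_sum gs U))%N).
Proof.
move=> irr conn; elim: j => [|j [gs [<- IH]]].
  by exists [::]; split=> //; right; rewrite muln0.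
have [g] := translate_gain U (translates_sum gs U) irr conn.
have -> : (translates_sum gs U + act g @: U)%VS = translates_sum (g :: gs) U.
  by rewrite /translates_sum big_cons addvC.
set N := \dim {:V} in IH *; move=> gain; exists (g :: gs); split=> //=.
have := dimvS (subvf (translates_sum gs U)).
have := dimvS (subvf (translates_sum (g :: gs) U)).
have le : (\dim (translates_sum gs U) <= \dim (translates_sum (g :: gs) U))%N.
  by rewrite dimvS // /translates_sum big_cons addvSr.
rewrite -/N => le1 le2; case: IH => [|IH]; first by left; lia.
have [|small] := ltnP (3 * (N - \dim (translates_sum gs U))) N.
  by left; lia.
right; have N0 : (0 < N)%N by rewrite lt0n dimv_eq0; apply/eqP; case: irr.
rewrite -(leq_pmul2l N0); nia.
Qed.

End LinearAction.

(** * Polynomial curves and limits of subspaces *)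

Section PolynomialCurves.
Variable F : fieldType.

Definition polynomial_curve (V : lmodType F) (f : F -> V) : Prop :=
  exists (n : nat) (w : nat -> V), forall t, f t = \sum_(i < n) t ^+ i *: w i.

Section Module.
Variable V : lmodType F.
Implicit Types (f g : F -> V) (v : V).

Lemma curve_eq f g : f =1 g -> polynomial_curve g -> polynomial_curve f.
Proof. by move=> fg [n [w gE]]; exists n, w => t; rewrite fg. Qed.

Lemma curve_monomial i v : polynomial_curve (fun t => t ^+ i *: v).
Proof.
exists i.+1, (fun l => if l == i then v else 0) => t.
rewrite big_ord_recr /= eqxx big1 ?add0r // => l _.
by rewrite ltn_eqF ?scaler0.
Qed.

Lemma curve_const v : polynomial_curve (fun=> v).
Proof. by apply: curve_eq (curve_monomial 0 v) => t; rewrite expr0 scale1r. Qed.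

Lemma curve_add f g : polynomial_curve f -> polynomial_curve g ->
  polynomial_curve (fun t => f t + g t).
Proof.
move=> [n1 [w1 fE]] [n2 [w2 gE]]; exists (n1 + n2)%N.
exists (fun i => (if (i < n1)%N then w1 i else 0) + (if (i < n2)%N then w2 i else 0)).
have pad n m (w : nat -> V) t : (n <= m)%N ->
    \sum_(i < n) t ^+ i *: w i = \sum_(i < m) t ^+ i *: (if (i < n)%N then w i else 0).
  move=> nm; rewrite (big_ord_widen m (fun i => t ^+ i *: w i)) // [LHS]big_mkcond.
  by apply: eq_bigr => i _; case: ifP => // _; rewrite scaler0.
move=> t; rewrite fE gE (pad n1 (n1 + n2)%N) ?leq_addr //.
rewrite (pad n2 (n1 + n2)%N) ?leq_addl // -big_split.
by apply: eq_bigr => i _; rewrite scalerDr.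
Qed.

Lemma curve_sum (I : Type) (r : seq I) (P : pred I) (f : I -> F -> V) :
  (forall i, P i -> polynomial_curve (f i)) ->
  polynomial_curve (fun t => \sum_(i <- r | P i) f i t).
Proof.
move=> fP; elim: r => [|i r IH].
  by apply: curve_eq (curve_const 0) => t; rewrite big_nil.
case Pi: (P i).
  apply: curve_eq (curve_add (fP i Pi) IH) => t.
  by rewrite big_cons Pi.
by apply: curve_eq IH => t; rewrite big_cons Pi.
Qed.

Lemma curve_linear (W : lmodType F) (l : {linear V -> W}) f :
  polynomial_curve f -> polynomial_curve (fun t => l (f t)).
Proof.
move=> [n [w fE]]; exists n, (fun i => l (w i)) => t.
by rewrite fE linear_sum; apply: eq_bigr => i _; rewrite linearZ_LR.
Qed.

Lemma curve_scale c f : polynomial_curve f -> polynomial_curve (fun t => c *: f t).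
Proof.
move=> [n [w fE]]; exists n, (fun i => c *: w i) => t.
by rewrite fE scaler_sumr; apply: eq_bigr => i _; rewrite !scalerA mulrC.
Qed.

End Module.

Lemma curve_poly (p : {poly F}) (V : lmodType F) (v : V) :
  polynomial_curve (fun t => p.[t] *: v).
Proof.
exists (size p), (fun i => p`_i *: v) => t; rewrite horner_coef scaler_suml.
by apply: eq_bigr => i _; rewrite scalerA mulrC.
Qed.

Lemma curve_scalar (V : lmodType F) (l : {scalar V}) (f : F -> V) :
  polynomial_curve f -> exists p : {poly F}, forall t, l (f t) = p.[t].
Proof.
move=> [n [w fE]]; exists (\sum_(i < n) (l (w i))%:P * 'X^i) => t.
rewrite fE linear_sum horner_sum; apply: eq_bigr => i _.
by rewrite hornerM hornerC hornerXn mulrC linearZ.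
Qed.

Section Algebra.
Variable A : comAlgType F.
Implicit Types f g : F -> A.

Lemma curve_mul f g : polynomial_curve f -> polynomial_curve g ->
  polynomial_curve (fun t => f t * g t).
Proof.
move=> [n [w fE]] [m [u gE]].
apply: (curve_eq (g := fun t =>
    \sum_(i < n) \sum_(j < m) t ^+ (i + j) *: (w i * u j))).
  move=> t; rewrite fE gE mulr_suml; apply: eq_bigr => i _.
  rewrite mulr_sumr; apply: eq_bigr => j _ /=.
  by rewrite -scalerAl -scalerAr scalerA exprD.
by apply: curve_sum => i _; apply: curve_sum => j _; apply: curve_monomial.
Qed.

Lemma curve_exp f b : polynomial_curve f -> polynomial_curve (fun t => f t ^+ b).
Proof.
move=> fP; elim: b => [|b IH]; first exact: curve_const.
by apply: curve_eq (curve_mul fP IH) => t; rewrite exprS.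
Qed.

Lemma curve_prod (I : Type) (r : seq I) (f : I -> F -> A) :
  (forall i, polynomial_curve (f i)) ->
  polynomial_curve (fun t => \prod_(i <- r) f i t).
Proof.
move=> fP; elim: r => [|i r IH].
  by apply: curve_eq (curve_const 1) => t; rewrite big_nil.
by apply: curve_eq (curve_mul (fP i) IH) => t; rewrite big_cons.
Qed.

End Algebra.

Section Limits.
Variable V : vectType F.
Implicit Types (Y Z : F -> {vspace V}) (v : V).

(** Membership in the limit of Y t as t tends to t0, read off polynomial curves;
    the value of Y at t0 is ignored, so that Y may degenerate there. *)
Definition is_limit Y t0 v : Prop :=
  exists f, [/\ polynomial_curve f, f t0 = v & forall t, t != t0 -> f t \in Y t].

Lemma limit_const Y t0 v : (forall t, v \in Y t) -> is_limit Y t0 v.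
Proof. by move=> vY; exists (fun=> v); split=> //; apply: curve_const. Qed.

Lemma limit_sub Y Z t0 v : (forall t, t != t0 -> (Y t <= Z t)%VS) ->
  is_limit Y t0 v -> is_limit Z t0 v.
Proof.
move=> YZ [f [fP f0 fY]]; exists f; split=> // t tt.
exact: subvP (YZ t tt) _ (fY t tt).
Qed.

Lemma limit_add Y t0 u v : is_limit Y t0 u -> is_limit Y t0 v -> is_limit Y t0 (u + v).
Proof.
move=> [f [fP f0 fY]] [g [gP g0 gY]]; exists (fun t => f t + g t).
by split=> [||t tt]; [apply: curve_add | rewrite f0 g0 | rewrite memvD ?fY ?gY].
Qed.

Lemma limit_scale Y t0 c v : is_limit Y t0 v -> is_limit Y t0 (c *: v).
Proof.
move=> [f [fP f0 fY]]; exists (fun t => c *: f t).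
by split=> [||t tt]; [apply: curve_scale | rewrite f0 | rewrite memvZ ?fY].
Qed.

Lemma limit_sum Y t0 (I : Type) (r : seq I) (P : pred I) (v : I -> V) :
  (forall i, P i -> is_limit Y t0 (v i)) ->
  is_limit Y t0 (\sum_(i <- r | P i) v i).
Proof.
move=> vP; apply: (big_ind (is_limit Y t0)) => //.
- by apply: limit_const => t; rewrite mem0v.
- exact: limit_add.
Qed.

Lemma limit_map Y t0 (h : 'End(V)) v :
  is_limit Y t0 v -> is_limit (fun t => h @: Y t)%VS t0 (h v).
Proof.
move=> [f [fP f0 fY]]; exists (fun t => h (f t)); split=> [||t tt].
- exact: curve_linear fP.
- by rewrite f0.
- by rewrite memv_img ?fY.
Qed.

(** Take curves in Y that pass through a basis of V at t0. Their determinant is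
    a polynomial in t with value 1 at t0; the factor 'X - t0 excludes t0 itself,
    where Y is not controlled. *)
Lemma full_limit_generic Y t0 : (forall v, is_limit Y t0 v) ->
  exists2 p : {poly F}, p != 0 & forall t, ~~ root p t -> Y t = fullv.
Proof.
move=> limY; pose e := vbasis {:V}.
have efree : basis_of fullv e by apply: vbasisP.
have [f fP] : exists f : 'I_(\dim {:V}) -> F -> V, forall j,
    [/\ polynomial_curve (f j), f j t0 = e`_j & forall t, t != t0 -> f j t \in Y t].
  by have [f fP] := choice (fun j : 'I_(\dim {:V}) => limY e`_j); exists f.
have [P PE] : exists P : 'I_(\dim {:V}) * 'I_(\dim {:V}) -> {poly F},
    forall jl t, coord e jl.2 (f jl.1 t) = (P jl).[t].
  have coordP (jl : 'I_(\dim {:V}) * 'I_(\dim {:V})) :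
      exists p : {poly F}, forall t, coord e jl.2 (f jl.1 t) = p.[t].
    by have [fjP _ _] := fP jl.1; apply: curve_scalar.
  by have [P PE] := choice coordP; exists P.
pose A t : 'M[F]_(\dim {:V}) := \matrix_(j, l) coord e l (f j t).
pose D : {poly F} := \det (\matrix_(j, l) P (j, l)).
have detA t : \det (A t) = D.[t].
  rewrite -[RHS]/(horner_eval t _) -det_map_mx; congr (\det _).
  by apply/matrixP => j l; rewrite !mxE (PE (j, l)).
have D0 : D.[t0] = 1.
  rewrite -detA; have -> : A t0 = 1%:M; last exact: det1.
  apply/matrixP => j l; rewrite !mxE; have [_ -> _] := fP j.
  by rewrite coord_free ?(basis_free efree) // eq_sym.
exists (D * ('X - t0%:P)) => [|t].
  rewrite mulf_neq0 ?polyXsubC_eq0 //.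
  by apply: contra_eq_neq D0 => ->; rewrite horner0 eq_sym oner_eq0.
rewrite rootM negb_or root_XsubC => /andP[Dt tt].
apply/eqP; rewrite eqEsubv subvf -(span_basis efree) /=.
apply/span_subvP => _ /tnthP[j ->].
have Aunit : A t \in unitmx by rewrite unitmxE detA unitfE.
have -> : tnth e j = \sum_l (invmx (A t)) j l *: f l t.
  have fE l : f l t = \sum_m A t l m *: e`_m.
    rewrite {1}(coord_basis efree (memvf (f l t))).
    by apply: eq_bigr => m _; rewrite mxE.
  transitivity (\sum_m (invmx (A t) *m A t) j m *: e`_m).
    rewrite mulVmx // (bigD1 j) //= mxE eqxx scale1r big1 ?addr0 ?(tnth_nth 0) //.
    by move=> m /negPf mj; rewrite mxE eq_sym mj scale0r.
  under [RHS]eq_bigr do rewrite fE scaler_sumr.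
  rewrite exchange_big; apply: eq_bigr => m _.
  by rewrite mxE scaler_suml; apply: eq_bigr => l _; rewrite scalerA.
by apply: memv_suml => l _; rewrite memvZ //; have [_ _ ->] := fP l.
Qed.

End Limits.
End PolynomialCurves.

(** Modulo W the curve is a polynomial that vanishes at infinitely many points,
    so its coefficients vanish modulo W. *)
Lemma curve_coef_mem (F : closedFieldType) (V : vectType F) (W : {vspace V})
    (n : nat) (w : nat -> V) :
  (forall t, t != 0 -> \sum_(i < n) t ^+ i *: w i \in W) ->
  forall i, (i < n)%N -> w i \in W.
Proof.
move=> curveW i i_n; pose q : 'End(V) := (\1 - projv W)%VF.
have qE v : (v \in W) = (q v == 0).
  rewrite add_lfunE opp_lfunE id_lfunE subr_eq0.
  by apply/idP/eqP => [/projv_id | ->] //; rewrite memv_proj.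
rewrite qE (coord_basis (vbasisP fullv) (memvf (q (w i)))) big1 // => j _.
pose p : {poly F} := \poly_(l < n) coord (vbasis fullv) j (q (w l)).
suff p0 : p = 0.
  have := coef_poly n (fun l => coord (vbasis fullv) j (q (w l))) i.
  by rewrite -/p p0 coef0 i_n => <-; rewrite scale0r.
apply/eqP; apply: contraT => p_neq0.
have /closed_nonrootP[t] : p * 'X != 0 by rewrite mulf_neq0 ?polyX_eq0.
rewrite rootM negb_or rootX => /andP[/negP npt t0]; case: npt.
have := curveW t t0; rewrite qE => /eqP qt; rewrite /root horner_poly.
rewrite (_ : \sum_(_ < _) _ = coord (vbasis fullv) j (q (\sum_(l < n) t ^+ l *: w l))).
  by rewrite qt linear0.
rewrite !linear_sum; apply: eq_bigr => l _.
by rewrite !linearZ /= mulrC.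
Qed.

(** * Monomials of the symmetric power *)

HB.instance Definition _ (R : nzRingType) (n : nat) (m : 'X_{1..n}) :=
  GRing.isScalable.Build R {mpoly R[n]} R *%R (mcoeff m)
    (fun c p => mcoeffZ c p m).

Section Monomials.
Variables (F : fieldType) (n k : nat).
Notation V := (Sym F n k).

(** The degree is bounded only to make this a finite type. *)
Definition monomial : finType := {m : 'X_{1..n.+1 < k.+1} | mdeg m == k}.

Definition expo (m : monomial) : 'X_{1..n.+1} := val (val m).

Lemma expo_inj : injective expo.
Proof. by move=> m1 m2 e; do 2!apply: val_inj. Qed.

Lemma mdeg_expo m : mdeg (expo m) = k.
Proof. exact/eqP/(valP m). Qed.

Lemma sum_expo m : (\sum_i expo m i = k)%N.
Proof. by rewrite -mdegE mdeg_expo. Qed.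

Lemma expo_le m i : (expo m i <= k)%N.
Proof. by rewrite -(sum_expo m) (bigD1 i) //= leq_addr. Qed.

Lemma monomial_of (m : 'X_{1..n.+1}) : mdeg m = k -> exists m', expo m' = m.
Proof.
move=> dm; have lt_m : (mdeg m < k.+1)%N by rewrite dm.
have eq_m : mdeg (BMultinom lt_m) == k by apply/eqP.
by exists (exist _ (BMultinom lt_m) eq_m).
Qed.

Fact monomial_vec_homog m : ('X_[expo m] : {mpoly F[n.+1]}) \is k.-homog.
Proof. by rewrite dhomogX /= mdeg_expo. Qed.

Definition monomial_vec (m : monomial) : V := DHomog (monomial_vec_homog m).

Definition monomial_coef (m : monomial) (p : V) : F := (val p)@_(expo m).

Lemma monomial_coefE m m' : monomial_coef m (monomial_vec m') = (m' == m)%:R.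
Proof. by rewrite /monomial_coef mcoeffX (inj_eq expo_inj). Qed.

Lemma Sym_expand (p : V) : p = \sum_m monomial_coef m p *: monomial_vec m.
Proof.
apply/val_inj/mpolyP => m; rewrite linear_sum linear_sum /=.
have [dm|dm] := eqVneq (mdeg m) k.
  have [m' <-] := monomial_of dm; rewrite (bigD1 m') //= big1 ?addr0.
    by rewrite mcoeffZ mcoeffX eqxx mulr1.
  by move=> m'' /negPf m''m'; rewrite mcoeffZ mcoeffX (inj_eq expo_inj) m''m' mulr0.
rewrite (dhomog_nemf_coeff (dhomog_is_dhomog p) dm) big1 // => m' _.
rewrite mcoeffZ mcoeffX; case: eqP => [e|_]; last by rewrite mulr0.
by rewrite -e mdeg_expo eqxx in dm.
Qed.

Implicit Types (m : monomial) (A : {set monomial}).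

Definition mono (A : {set monomial}) : {vspace V} :=
  (\sum_(m in A) <[monomial_vec m]>)%VS.

Lemma mem_mono A m : m \in A -> monomial_vec m \in mono A.
Proof. by move=> mA; rewrite memvE /mono (sumv_sup m). Qed.

Lemma monoP A (W : {vspace V}) :
  reflect (forall m, m \in A -> monomial_vec m \in W) (mono A <= W)%VS.
Proof.
apply: (iffP subv_sumP) => AW m /AW; first by rewrite -memvE.
by rewrite -memvE.
Qed.

Lemma full_monomials (W : {vspace V}) :
  (forall m, monomial_vec m \in W) -> W = fullv.
Proof.
move=> allW; apply/eqP; rewrite eqEsubv subvf /=; apply/subvP => p _.
by rewrite [p]Sym_expand memv_suml // => m _; rewrite memvZ.
Qed.

Lemma dim_Sym_le : (\dim {:V} <= #|monomial|)%N.
Proof.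
have <- : mono setT = fullv by apply: full_monomials => m; rewrite mem_mono ?inE.
apply: leq_trans (dimv_leq_sum _ _ _) _.
by rewrite -cardsT -sum1_card; apply: leq_sum => m _; rewrite dim_vline leq_b1.
Qed.

Lemma exists_monomial : exists m : monomial, expo m = (U_(ord0) *+ k)%MM.
Proof. by apply: monomial_of; rewrite mdegMn mdeg1 mul1n. Qed.

Lemma monomial_vec_neq0 m : monomial_vec m != 0.
Proof.
apply/negP => /eqP m0; have := monomial_coefE m m.
by rewrite m0 /monomial_coef mcoeff0 eqxx => /eqP; rewrite eq_sym oner_eq0.
Qed.

Lemma Sym_neq0 : {:V}%VS <> 0%VS.
Proof.
move=> V0; have [m _] := exists_monomial; have := memvf (monomial_vec m).
by rewrite V0 memv0 (negPf (monomial_vec_neq0 m)).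
Qed.

Lemma monomial_complement (U : {vspace V}) :
  exists2 A : {set monomial},
    (#|A| <= \dim {:V} - \dim U)%N & (U + mono A = fullv)%VS.
Proof.
have [c] := ubnP (\dim {:V} - \dim U); elim: c U => // c IH U ltc.
have [/forallP allU|] := boolP [forall m, monomial_vec m \in U].
  exists set0; first by rewrite cards0.
  by rewrite (full_monomials allU) addvC /mono big_set0 add0v.
rewrite negb_forall => /existsP[m mU].
have le1 := dimvS (subvf (U + <[monomial_vec m]>)%VS).
have lt1 : (\dim U < \dim (U + <[monomial_vec m]>))%N.
  by rewrite ltn_neqAle (dimv_leqif_sup (addvSl _ _)) dimvS ?addvSl // andbT
     subv_add subvv /= -memvE.
have [|A Ac AU] := IH (U + <[monomial_vec m]>)%VS; first by lia.
exists (m |: A); first by rewrite cardsU1; lia.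
apply: full_monomials => m'; have := memvf (monomial_vec m'); rewrite -AU.
apply/subvP; rewrite -addvA addvS // subv_add -memvE mem_mono ?setU11 //=.
by apply/monoP => m'' m''A; rewrite mem_mono // setU1r.
Qed.

Lemma Sym_subst_monomial (g : 'M[F]_n.+1) m :
  val (Sym_subst g (monomial_vec m)) =
    \prod_j (\sum_i g i j *: 'X_i : {mpoly F[n.+1]}) ^+ expo m j.
Proof.
by rewrite /= comp_mpolyX; apply: eq_bigr => j _; rewrite tnth_mktuple.
Qed.

Lemma Sym_substZ c (g : 'M[F]_n.+1) (p : V) :
  Sym_subst (c *: g) p = c ^+ k *: Sym_subst g p.
Proof.
rewrite [p]Sym_expand !linear_sum; apply: eq_bigr => m _.
transitivity (monomial_coef m p *: (c ^+ k *: Sym_subst g (monomial_vec m)));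
  last by rewrite !linearZ /= !scalerA mulrC.
rewrite linearZ /=; congr (_ *: _).
apply: val_inj; rewrite [LHS]Sym_subst_monomial.
rewrite -[RHS]/(c ^+ k *: val (Sym_subst g (monomial_vec m))).
rewrite Sym_subst_monomial.
under eq_bigr => j _.
  under eq_bigr do rewrite mxE -scalerA.
  rewrite -scaler_sumr exprZn; over.
by rewrite scaler_prod prodrXr sum_expo.
Qed.

Lemma curve_Sym_subst (A : F -> 'M[F]_n.+1) (P : 'M[{poly F}]_n.+1) (p : V) :
  (forall t i j, A t i j = (P i j).[t]) ->
  polynomial_curve (fun t => Sym_subst (A t) p).
Proof.
move=> AP.
have coefP m : exists q : {poly F}, forall t,
    monomial_coef m (Sym_subst (A t) p) = q.[t].
  apply: (@curve_scalar _ _ (mcoeff (expo m))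
            (fun t => val (Sym_subst (A t) p))).
  apply: (curve_eq (g := fun t => \sum_m' monomial_coef m' p *:
            \prod_j (\sum_i (P i j).[t] *: 'X_i : {mpoly F[n.+1]}) ^+ expo m' j)).
    move=> t; rewrite {1}[p]Sym_expand !linear_sum; apply: eq_bigr => m' _.
    rewrite !linearZ; congr (_ *: _); rewrite [LHS]Sym_subst_monomial.
    apply: eq_bigr => j _.
    by congr (_ ^+ _); apply: eq_bigr => i _; rewrite AP.
  apply: curve_sum => m' _; apply: curve_scale; apply: curve_prod => j.
  by apply: curve_exp; apply: curve_sum => i _; apply: curve_poly.
have [q qE] := choice coefP.
apply: (curve_eq (g := fun t => \sum_m (q m).[t] *: monomial_vec m)).
  by move=> t; rewrite [LHS]Sym_expand; apply: eq_bigr => m _; rewrite qE.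
by apply: curve_sum => m _; apply: curve_poly.
Qed.

End Monomials.

(** * Matrices acting by substitution *)

Section Substitutions.
Variables (F : numClosedFieldType) (n k : nat).
Notation V := (Sym F n k).
Notation act := (Sym_action F n k).
Implicit Types (m : monomial n k) (U Y Z : {vspace V}).

Lemma Sym_actionE (g : SL F n.+1) (p : V) : act g p = Sym_subst (val g) p.
Proof. by rewrite /= lfunE. Qed.

(** A scalar matrix acts on the symmetric power by a scalar, and roots of the
    determinant exist, so invertible matrices move subspaces no further than
    SL does. *)
Lemma SL_of_unitmx (g : 'M[F]_n.+1) : g \in unitmx ->
  exists h : SL F n.+1, exists2 c, c != 0 &
    forall p : V, Sym_subst g p = c *: act h p.
Proof.
rewrite unitmxE unitfE => detg; pose a := n.+1.-root ((\det g)^-1).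
have aE : a ^+ n.+1 = (\det g)^-1 by rewrite rootCK.
have a0 : a != 0 by rewrite rootC_eq0 ?invr_eq0.
have det1 : \det (a *: g) == 1 by rewrite detZ aE mulVf.
exists (exist _ (a *: g) det1), (a ^- k) => [|p]; first by rewrite invr_eq0 expf_neq0.
by rewrite Sym_actionE /= Sym_substZ scalerA mulVf ?scale1r // expf_neq0.
Qed.

(** The line through g1 and g2 in the space of matrices joins the two elements;
    its general point is invertible and satisfies both conditions, which are open
    along the line. *)
Lemma Sym_connected : connected_action act.
Proof.
move=> U Y Z [g1 fullY] [g2 fullZ].
pose A t := val g1 + t *: (val g2 - val g1).
pose P : 'M[{poly F}]_n.+1 :=
  \matrix_(i, j) ((val g1 i j)%:P + 'X * (val g2 i j - val g1 i j)%:P).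
have AP t i j : A t i j = (P i j).[t].
  by rewrite !mxE hornerD hornerM hornerX !hornerC.
have [A0 A1] : A 0 = val g1 /\ A 1 = val g2.
  by rewrite /A scale0r addr0 scale1r addrC subrK.
have detA t : \det (A t) = (\det P).[t].
  rewrite -[RHS]/(horner_eval t _) -det_map_mx; congr (\det _).
  by apply/matrixP => i j; rewrite AP !mxE.
pose M t (W : {vspace V}) := (linfun (Sym_subst (A t)) @: U + W)%VS : {vspace V}.
have limM t0 g W : A t0 = val g -> (act g @: U + W = fullv)%VS ->
    forall v, is_limit (fun t => M t W) t0 v.
  move=> At0 full v; have := memvf v; rewrite -full.
  move=> /memv_addP[_ /memv_imgP[u uU ->] [w wW ->]].
  exists (fun t => Sym_subst (A t) u + w); split=> [||t _].
  - by apply: curve_add; [apply: curve_Sym_subst AP | apply: curve_const].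
  - by rewrite At0 Sym_actionE.
  - by rewrite memv_add // -lfunE memv_img.
have [p1 p1_neq0 p1P] := full_limit_generic (limM 0 g1 Y A0 fullY).
have [p2 p2_neq0 p2P] := full_limit_generic (limM 1 g2 Z A1 fullZ).
have detP : \det P != 0.
  apply: contra_eq_neq (detA 0) => ->.
  by rewrite A0 SL_det horner0 oner_eq0.
have /closed_nonrootP[t] : p1 * p2 * \det P != 0 by rewrite !mulf_neq0.
rewrite !rootM !negb_or => /andP[/andP[/p1P fullYt /p2P fullZt]].
rewrite /root -detA -unitfE -unitmxE => /SL_of_unitmx[h [c _ hE]].
have sub W : (M t W <= act h @: U + W)%VS.
  rewrite addvS //; apply/subvP => _ /memv_imgP[u uU ->].
  by rewrite lfunE /= hE memvZ // memv_img.
by exists h; split; apply/eqP; rewrite eqEsubv subvf /=;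
  [rewrite -fullYt | rewrite -fullZt].
Qed.

Lemma torus_monomial (w : 'I_n.+1 -> nat) (t : F) (m : monomial n k) :
  Sym_subst (diag_mx (\row_i t ^+ w i)) (monomial_vec F m) =
    t ^+ (\sum_i w i * expo m i) *: monomial_vec F m.
Proof.
apply: val_inj; rewrite [LHS]Sym_subst_monomial.
rewrite -[RHS]/(_ *: 'X_[expo m]) mpolyXE_id -prodrXr -scaler_prod.
apply: eq_bigr => j _; rewrite exprM -exprZn; congr (_ ^+ _).
rewrite (bigD1 j) //= !mxE eqxx mulr1n big1 ?addr0 // => i /negPf ij.
by rewrite !mxE ij scale0r.
Qed.

Lemma perm_monomial (s : 'S_n.+1) (m m' : monomial n k) :
  (forall i, expo m' i = expo m (s i)) ->
  Sym_subst (perm_mx s) (monomial_vec F m) = monomial_vec F m'.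
Proof.
move=> m'E; apply: val_inj; rewrite [LHS]Sym_subst_monomial.
rewrite -[RHS]/('X_[expo m']) mpolyXE_id (reindex_inj (@perm_inj _ s)) /=.
apply: eq_bigr => i _; rewrite m'E; congr (_ ^+ _).
rewrite (bigD1 i) //= !mxE eqxx scale1r big1 ?addr0 // => l li.
by rewrite !mxE (inj_eq perm_inj) (negPf li) scale0r.
Qed.

(** The substitution 'X_j := 'X_j + s 'X_i. *)
Definition transvection (i j : 'I_n.+1) (s : F) : 'M[F]_n.+1 :=
  1%:M + s *: delta_mx i j.

Lemma transvection_unit i j s : i != j -> transvection i j s \in unitmx.
Proof.
move=> ij; suff /mulmx1_unit[] : transvection i j s *m transvection i j (- s) = 1%:M.
  by [].
rewrite /transvection mulmxDl mul1mx mulmxDr mulmx1 -!scalemxAl -!scalemxAr.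
by rewrite mul_delta_mx_0 ?(eq_sym j) // !scaler0 addr0 scaleNr ?(addrK, subrK).
Qed.

(** The coefficients w 0 and w 1 of the expansion in s are what lets a
    transvection exchange one factor 'X_j for 'X_i; the factor expo m j of w 1
    is invertible as the characteristic is 0. *)
Lemma transvection_monomial i j m : i != j ->
  exists w : nat -> V, [/\
    forall s, Sym_subst (transvection i j s) (monomial_vec F m) =
      \sum_(l < (expo m j).+1) s ^+ l *: w l,
    w 0%N = monomial_vec F m
  & forall m', (expo m' + U_(j) = expo m + U_(i))%MM ->
      w 1%N = (expo m j)%:R *: monomial_vec F m'].
Proof.
move=> ij; pose b := expo m j.
pose ml l : 'X_{1..n.+1} := [multinom (if a == j then b - l else
   if a == i then expo m a + l else expo m a)%N | a < n.+1].
pose w l : V := insubd (0 : V) ('C(b, l)%:R *: 'X_[ml l] : {mpoly F[n.+1]}).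
have wE l : (l <= b)%N -> val (w l) = 'C(b, l)%:R *: 'X_[ml l].
  move=> lb.
  suff hX : ('X_[ml l] : {mpoly F[n.+1]}) \is k.-homog.
    by rewrite insubdK //; apply: rpredZ.
  rewrite dhomogX /=.
  have := sum_expo m; rewrite mdegE !(bigD1 j (P := xpredT)) //=.
  rewrite !(bigD1 i (P := fun a => a != j)) //=.
  rewrite !mnmE eqxx (negPf ij) eqxx -/b.
  rewrite [in X in _ -> X](eq_bigr (fun a => expo m a)); first by lia.
  by move=> a /andP[/negPf aj /negPf ai]; rewrite mnmE aj ai.
exists w; split=> [s||m' m'E].
- apply: val_inj; rewrite [LHS]Sym_subst_monomial linear_sum /=.
  rewrite (bigD1 j) //= -/b.
  have -> : \sum_a transvection i j s a j *: 'X_a = 'X_j + s *: 'X_i :> {mpoly F[n.+1]}.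
    rewrite (bigD1 j) //= (bigD1 i) //= big1 ?addr0 => [|a /andP[/negPf aj /negPf ai]].
      by rewrite !mxE !eqxx (negPf ij) eq_sym (negPf ij) mulr0 addr0 add0r mulr1 scale1r.
    by rewrite !mxE aj ai /= mulr0 addr0 scale0r.
  rewrite exprDn mulr_suml; apply: eq_bigr => l _.
  have lb : (l <= b)%N by rewrite -ltnS.
  rewrite -[RHS]/(s ^+ l *: val (w l)) wE // exprZn.
  rewrite (eq_bigr (fun a => 'X_a ^+ expo m a)) => [|a /negPf aj]; last first.
    congr (_ ^+ _); rewrite (bigD1 a) //= big1 ?addr0 => [|c /negPf ca].
      by rewrite !mxE eqxx aj andbF mulr0 addr0 scale1r.
    by rewrite !mxE ca aj andbF mulr0 addr0 scale0r.
  rewrite scaler_nat -scalerMnr mulrnAl -scalerAr -scalerAl.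
  congr (_ *+ _); congr (_ *: _).
  rewrite [RHS]mpolyXE_id [RHS](bigD1 j) //= [in RHS](bigD1 i) //= [in LHS](bigD1 i) //=.
  rewrite !mnmE eqxx (negPf ij) eqxx -mulrA; congr (_ * _).
  rewrite mulrA -exprD addnC; congr (_ * _).
  by apply: eq_bigr => a /andP[/negPf aj /negPf ai]; rewrite mnmE aj ai.
- apply: val_inj; rewrite wE // bin0 scale1r; congr 'X_[_].
  apply/mnmP => a; rewrite mnmE subn0 addn0.
  by case: eqP => [->|_] //; case: ifP.
- have b0 : (0 < b)%N.
    have /mnmP/(_ j) := m'E; rewrite !mnmDE !mnm1E eqxx (negPf ij) addn0 -/b => <-.
    by rewrite addn1.
  apply: val_inj; rewrite wE // bin1; congr (_ *: 'X_[_]).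
  apply/mnmP => a; have /mnmP/(_ a) := m'E.
  rewrite !mnmDE !mnm1E mnmE -/b ![_ == a]eq_sym.
  case: eqP => [->|_]; first by rewrite (eq_sym j) (negPf ij) -/b; lia.
  by case: eqP => [->|_] /=; lia.
Qed.

End Substitutions.

(** * Exchanges and weights of monomials *)

Section Exchange.
Variables (n k : nat).
Implicit Types (m p : monomial n k) (A : {set monomial n k}).

Lemma exchange_exists (i j : 'I_n.+1) m : (0 < expo m j)%N ->
  exists m', (expo m' + U_(j) = expo m + U_(i))%MM.
Proof.
move=> mj; have le : (U_(j) <= expo m)%MM by rewrite lep1mP -lt0n.
have [|m' m'E] := @monomial_of n k (expo m - U_(j) + U_(i)).
  have := mdegD (expo m - U_(j)) U_(j).
  by rewrite submK // mdegD !mdeg1 mdeg_expo.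
by exists m'; rewrite m'E -addmA [(U_(i) + _)%MM]addmC addmA submK.
Qed.

(** Any monomial is reached from any other of the same degree by exchanging an
    exponent in excess for one in default. *)
Lemma exchange_connected (P : monomial n k -> Prop) m0 :
  (forall m m' (i j : 'I_n.+1), i != j ->
     (expo m' + U_(j) = expo m + U_(i))%MM -> P m -> P m') ->
  P m0 -> forall m, P m.
Proof.
move=> exch P0 m; have [d] := ubnP (\sum_i (expo m0 i - expo m i)).
elim: d m0 P0 => // d IH m0 P0 ltd.
have [/eqP e0|] := eqVneq (\sum_i (expo m0 i - expo m i))%N 0%N.
  suff <- : m0 = m by [].
  have le i : (expo m0 i <= expo m i)%N.
    by move: e0; rewrite sum_nat_eq0 => /forallP/(_ i).
  apply/expo_inj/mnmP => i.
  have : (\sum_i expo m0 i == \sum_i expo m i)%N by rewrite !sum_expo.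
  have /leqif_sum/= [_ ->] : forall l, true ->
      (expo m0 l <= expo m l ?= iff (expo m0 l == expo m l))%N by move=> l _; split.
  by move=> /forallP/(_ i)/eqP.
rewrite sum_nat_eq0 negb_forall => /existsP[j]; rewrite /= subn_eq0 -ltnNge => ltj.
have [i lti] : exists i, (expo m0 i < expo m i)%N.
  apply/existsP; apply: contraLR ltj; rewrite negb_exists -leqNgt => /forallP ge.
  have : (\sum_i expo m i == \sum_i expo m0 i)%N by rewrite !sum_expo.
  have /leqif_sum/= [_ ->] : forall l, true ->
      (expo m l <= expo m0 l ?= iff (expo m l == expo m0 l))%N.
    by move=> l _; split=> //; rewrite leqNgt.
  by move=> /forallP/(_ j)/eqP ->.
have ij : i != j by apply: contraTneq lti => ->; rewrite -leqNgt ltnW.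
have [m1 m1E] := @exchange_exists i j m0 (leq_ltn_trans (leq0n _) ltj).
apply: (IH m1); first exact: exch ij m1E P0.
rewrite -ltnS; apply: leq_trans ltd; rewrite ltnS.
have m1l l : (expo m1 l + (j == l) = expo m0 l + (i == l))%N.
  by have /mnmP/(_ l) := m1E; rewrite !mnmDE !mnm1E.
rewrite (bigD1 j) //= [X in (_ < X)%N](bigD1 j) //= -addSn leq_add //.
  by have := m1l j; rewrite eqxx (negPf ij); lia.
apply: leq_sum => l lj; have := m1l l; rewrite eq_sym (negPf lj).
by case: eqP => [<-|_]; lia.
Qed.

(** The exponents, which are at most k, are the digits of the weight, so distinct
    monomials have distinct weights. Base k + 2 rather than k + 1 keeps the base
    above 1 for k = 0. *)
Definition weight m : nat := (\sum_(i < n.+1) k.+2 ^ i * expo m i)%N.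

Lemma digits_inj b r (a c : 'I_r -> nat) :
  (forall i, a i < b)%N -> (forall i, c i < b)%N ->
  (\sum_(i < r) b ^ i * a i = \sum_(i < r) b ^ i * c i)%N -> a =1 c.
Proof.
elim: r a c => [|r IH] a c ab cb; first by move=> _ [].
have split_sum (x : 'I_r.+1 -> nat) : (\sum_(i < r.+1) b ^ i * x i =
    (\sum_(i < r) b ^ i * x (lift ord0 i)) * b + x ord0)%N.
  rewrite big_ord_recl mul1n addnC; congr (_ + _)%N; rewrite big_distrl /=.
  by apply: eq_bigr => i _; rewrite expnS -mulnA mulnC.
rewrite !split_sum => e.
have e0 : a ord0 = c ord0.
  by have := congr1 (modn^~ b) e; rewrite /= !modnMDl !modn_small.
have b0 : (0 < b)%N by apply: leq_ltn_trans (ab ord0).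
move: e; rewrite e0 => /eqP; rewrite eqn_add2r eqn_pmul2r // => /eqP e i.
case: (unliftP ord0 i) => [l ->|-> //].
by apply: (IH (fun l => a (lift ord0 l)) (fun l => c (lift ord0 l))).
Qed.

Lemma weight_inj : injective weight.
Proof.
move=> m m' e; apply/expo_inj/mnmP; apply: digits_inj e => i.
  by rewrite ltnS (leq_trans (expo_le m i)).
by rewrite ltnS (leq_trans (expo_le m' i)).
Qed.

Lemma weight_exchange m m' (i j : 'I_n.+1) : (i < j)%N ->
  (expo m' + U_(j) = expo m + U_(i))%MM -> (weight m' < weight m)%N.
Proof.
move=> ij /mnmP e.
have weight1 (l : 'I_n.+1) : (\sum_(a < n.+1) k.+2 ^ a * (l == a) = k.+2 ^ l)%N.
  rewrite (bigD1 l) //= eqxx muln1 big1 ?addn0 // => a /negPf al.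
  by rewrite eq_sym al muln0.
have : (weight m' + k.+2 ^ j = weight m + k.+2 ^ i)%N.
  rewrite -!weight1 -!big_split /=; apply: eq_bigr => l _.
  by rewrite -!mulnDr; have := e l; rewrite !mnmDE !mnm1E => ->.
by have := @ltn_exp2l k.+2 i j isT; rewrite ij; lia.
Qed.

Definition total_weight A : nat := (\sum_(m in A) weight m)%N.

Lemma total_weight_swap A m p : m \notin A -> p \in A ->
  (total_weight (m |: A :\ p) + weight p = total_weight A + weight m)%N.
Proof.
move=> mA pA; rewrite /total_weight big_setU1 ?inE ?(negPf mA) ?andbF //=.
by rewrite (big_setD1 p pA) /=; lia.
Qed.

Lemma card_swap A m p : p \in A -> (#|m |: A :\ p| <= #|A|)%N.
Proof.
by move=> pA; rewrite cardsU1 (cardsD1 p A) pA leq_add2r leq_b1.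
Qed.

End Exchange.

(** * Irreducibility of the symmetric power *)

Section Degeneration.
Variables (F : numClosedFieldType) (n k : nat).
Notation V := (Sym F n k).
Notation act := (Sym_action F n k).
Implicit Types (m p : monomial n k) (A : {set monomial n k}) (U W Z : {vspace V}).

Definition torus (t : F) : 'M[F]_n.+1 := diag_mx (\row_i t ^+ (k.+2 ^ i)).

Lemma torus_weight t m :
  Sym_subst (torus t) (monomial_vec F m) = t ^+ weight m *: monomial_vec F m.
Proof. by rewrite torus_monomial. Qed.

Lemma torus_unit t : t != 0 -> torus t \in unitmx.
Proof.
move=> t0; rewrite unitmxE det_diag unitfE prodf_seq_neq0.
by apply/allP => i _; rewrite mxE expf_neq0.
Qed.

Lemma subst_sub_action (g : 'M[F]_n.+1) : g \in unitmx ->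
  exists h : SL F n.+1, forall W,
    (linfun (Sym_subst g) @: W <= act h @: W)%VS.
Proof.
move=> /(SL_of_unitmx k)[h [c _ hE]]; exists h => W.
by apply/subvP => _ /memv_imgP[u uW ->]; rewrite lfunE /= hE memvZ // memv_img.
Qed.

Lemma subst_stable W (g : 'M[F]_n.+1) (p : V) :
  (forall h, (act h @: W <= W)%VS) -> g \in unitmx -> p \in W -> Sym_subst g p \in W.
Proof.
move=> stable /subst_sub_action[h hW] pW.
apply: (subvP (stable h)); apply: (subvP (hW W)).
by rewrite -[Sym_subst g p]lfunE memv_img.
Qed.

(** A stable subspace contains the weight components of its vectors, hence a
    monomial, hence by transvections all monomials. *)
Lemma Sym_irreducible : irreducible_action act.
Proof.
split=> [|W stable]; first exact: Sym_neq0.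
have [->|/eqP W0] := eqVneq W 0%VS; [by left | right].
pose f := vpick W; have fW : f \in W := memv_pick W.
have [m0 m0f] : exists m, monomial_coef m f != 0.
  have [/existsP //|] := boolP [exists m : monomial n k, monomial_coef m f != 0].
  rewrite negb_exists => /forallP f0; case: W0; apply/eqP.
  rewrite -vpick0 -/f [f]Sym_expand big1 // => m _.
  by have := f0 m; rewrite negbK => /eqP ->; rewrite scale0r.
pose w l : V := \sum_(m : monomial n k | weight m == l)
  monomial_coef m f *: monomial_vec F m.
have torus_curve t : Sym_subst (torus t) f =
    \sum_(l < (\max_(m : monomial n k) weight m).+1) t ^+ l *: w l.
  rewrite {1}[f]Sym_expand linear_sum /w.
  under [RHS]eq_bigr do rewrite scaler_sumr.
  rewrite (exchange_big_dep xpredT) //=; apply: eq_bigr => m _.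
  have lt_m : (weight m < (\max_(m : monomial n k) weight m).+1)%N.
    by rewrite ltnS leq_bigmax.
  rewrite (big_pred1 (Ordinal lt_m)) => [|l]; last by rewrite eq_sym.
  by rewrite linearZ /= torus_weight !scalerA mulrC.
have W_m0 : monomial_vec F m0 \in W.
  have : w (weight m0) \in W.
    apply: (curve_coef_mem (n := (\max_(m : monomial n k) weight m).+1)).
      by move=> t t0; rewrite -torus_curve subst_stable ?torus_unit.
    by rewrite ltnS leq_bigmax.
  rewrite /w (big_pred1 m0) => [|m]; last by rewrite (inj_eq (@weight_inj n k)).
  by move=> /(memvZ (monomial_coef m0 f)^-1); rewrite scalerA mulVf ?scale1r.
apply: full_monomials => m.
apply: (exchange_connected (P := fun m => monomial_vec F m \in W)) W_m0 m.
move=> m m' i j ij m'E mW.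
have [w' [w'E _ /(_ m' m'E) w1]] := transvection_monomial F m ij.
have mj : (0 < expo m j)%N.
  have /mnmP/(_ j) := m'E; rewrite !mnmDE !mnm1E eqxx (negPf ij) addn0 => <-.
  by rewrite addn1.
have : w' 1%N \in W.
  apply: (curve_coef_mem (n := (expo m j).+1)) => // s _.
  by rewrite -w'E subst_stable ?transvection_unit.
rewrite w1 => /(memvZ ((expo m j)%:R^-1)).
by rewrite scalerA mulVf ?scale1r // pnatr_eq0 -lt0n.
Qed.

(** * Degeneration to a span of monomials *)

Definition limit_incl (Y : F -> {vspace V}) t0 W := forall v, v \in W -> is_limit Y t0 v.

Lemma limit_incl_add Y t0 W Z :
  limit_incl Y t0 W -> limit_incl Y t0 Z -> limit_incl Y t0 (W + Z)%VS.
Proof. by move=> YW YZ _ /memv_addP[w /YW lw [z /YZ lz ->]]; apply: limit_add. Qed.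

Lemma limit_incl_sum Y t0 (I : Type) (r : seq I) (P : pred I) (W : I -> {vspace V}) :
  (forall i, P i -> limit_incl Y t0 (W i)) ->
  limit_incl Y t0 (\sum_(i <- r | P i) W i)%VS.
Proof.
move=> YW; apply: (big_ind (limit_incl Y t0)) => //.
  by move=> v; rewrite memv0 => /eqP ->; apply: limit_const => t; rewrite mem0v.
exact: limit_incl_add.
Qed.

Lemma limit_incl_mono Y t0 A :
  (forall m, m \in A -> is_limit Y t0 (monomial_vec F m)) ->
  limit_incl Y t0 (mono F A).
Proof.
move=> YA; apply: limit_incl_sum => m mA _ /vlineP[c ->].
exact: limit_scale (YA m mA).
Qed.

Definition mono_complement U A : Prop :=
  (#|A| <= \dim {:V} - \dim U)%N /\
  exists g, (act g @: U + mono F A = fullv)%VS.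

(** The complement of A plays the role of the generic initial monomials of U,
    found by a maximality that ranges over all translates of U at once. *)
Definition extremal_complement U A : Prop :=
  mono_complement U A /\
  forall B, mono_complement U B -> (total_weight B <= total_weight A)%N.

Lemma exists_extremal_complement U : exists A, extremal_complement U A.
Proof.
have [A0 cardA0 fullA0] := monomial_complement U.
have compA0 : mono_complement U A0.
  by split=> //; exists 1%g; rewrite action1 lim1g.
have [|[A compA] maxA] := @exists_maximum {A | mono_complement U A}
    (@total_weight n k \o sval) (total_weight [set: monomial n k])
    (exist _ A0 compA0).
  move=> [B _] /=; rewrite /total_weight [X in (_ <= X)%N](big_setID B) /=.
  by rewrite setTI leq_addr.
by exists A; split=> // B compB; apply: (maxA (exist _ B compB)).
Qed.

Section Extremal.
Variables (U : {vspace V}) (A : {set monomial n k}).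
Hypothesis extA : extremal_complement U A.

Lemma extremal_swap m p : m \notin A -> p \in A ->
  (exists g, act g @: U + mono F (m |: A :\ p) = fullv)%VS ->
  (weight m <= weight p)%N.
Proof.
case: extA => -[cardA _] maxA mA pA full.
have /maxA : mono_complement U (m |: A :\ p).
  by split=> //; apply: leq_trans cardA; apply: card_swap.
by have := total_weight_swap mA pA; lia.
Qed.

(** If a monomial p of smaller weight than m occurred here, p and m could be
    exchanged in A, against extremality. *)
Lemma extremal_expand g m : (act g @: U + mono F A = fullv)%VS -> m \notin A ->
  exists2 c : monomial n k -> F,
    monomial_vec F m - \sum_(p in A) c p *: monomial_vec F p \in (act g @: U)%VS &
    forall p, p \in A -> c p != 0 -> (weight m < weight p)%N.
Proof.
move=> full mA; have := memvf (monomial_vec F m); rewrite -full.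
move=> /memv_addP[u uU [a /memv_sumP[v vA ->] e]].
pose c p := monomial_coef p (v p).
have vE p : p \in A -> v p = c p *: monomial_vec F p.
  move=> /vA/vlineP[x]; rewrite /c => ->; congr (_ *: _).
  by rewrite /monomial_coef mcoeffZ mcoeffX eqxx mulr1.
rewrite (eq_bigr _ vE) in e.
exists c => [|p pA cp]; first by rewrite e addrK.
have neq_mp : m != p by apply: contraNneq mA => ->.
rewrite ltn_neqAle (inj_eq (@weight_inj n k)) neq_mp.
apply: extremal_swap => //; exists g; apply/eqP; rewrite eqEsubv subvf -full.
rewrite subv_add addvSl; apply/monoP => q qA.
have [->|qp] := eqVneq q p; last first.
  by rewrite (subvP (addvSr _ _)) // mem_mono // !inE qp qA orbT.
have -> : monomial_vec F p = (c p)^-1 *: (monomial_vec F m - u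
    - \sum_(q in A | q != p) c q *: monomial_vec F q).
  by rewrite e (bigD1 p) //= [u + _]addrC !addrK scalerA mulVf ?scale1r.
rewrite memvZ //; apply: memvB; last first.
  apply: memv_suml => r /andP[rA rp]; rewrite memvZ // (subvP (addvSr _ _)) //.
  by rewrite mem_mono // !inE rp rA orbT.
apply: memvB; last exact: subvP (addvSl _ _) _ uU.
by rewrite (subvP (addvSr _ _)) // mem_mono // setU11.
Qed.

(** The vectors of a translate of U with exactly one monomial outside A have it
    as their term of lowest weight, and after rescaling the torus kills the
    others. *)
Lemma torus_limit g : (act g @: U + mono F A = fullv)%VS ->
  limit_incl (fun t => linfun (Sym_subst (torus t)) @: (act g @: U))%VS 0
    (mono F (~: A)).
Proof.
move=> full; apply: limit_incl_mono => m; rewrite inE => mA.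
have [c uU cE] := extremal_expand full mA.
exists (fun t => monomial_vec F m -
  \sum_(p in A) t ^+ (weight p - weight m) *: (c p *: monomial_vec F p)).
split=> [||t t0].
- apply: curve_add; first exact: curve_const.
  apply: (curve_eq (g := fun t => -1 *: \sum_(p in A)
      t ^+ (weight p - weight m) *: (c p *: monomial_vec F p))).
    by move=> t; rewrite scaleN1r.
  by apply: curve_scale; apply: curve_sum => p _; apply: curve_monomial.
- rewrite big1 ?subr0 // => p pA; have [->|cp] := eqVneq (c p) 0.
    by rewrite scale0r scaler0.
  by rewrite expr0n subn_eq0 leqNgt cE // scale0r.
- pose u := monomial_vec F m - \sum_(p in A) c p *: monomial_vec F p.
  suff -> : monomial_vec F m -
      \sum_(p in A) t ^+ (weight p - weight m) *: (c p *: monomial_vec F p) =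
      t ^- weight m *: Sym_subst (torus t) u.
    by rewrite memvZ // -lfunE memv_img.
  rewrite linearB /= torus_weight scalerBr scalerA mulVf ?expf_neq0 //.
  rewrite scale1r; congr (_ - _); rewrite linear_sum scaler_sumr; apply: eq_bigr => p pA.
  rewrite /= [Sym_subst _ _]linearZ /= torus_weight !scalerA.
  have [->|cp] := eqVneq (c p) 0; first by rewrite !(mulr0, mul0r).
  have /ltnW/subnK {2}<- := cE p pA cp.
  by rewrite exprD; congr (_ *: _); field; rewrite expf_neq0.
Qed.

(** Filling V is an open condition, so what the limit of a translate of U does,
    a translate of U does already. *)
Lemma degeneration hs Z :
  (translates_sum act hs (mono F (~: A)) + Z = fullv)%VS ->
  exists g, (translates_sum act hs (act g @: U) + Z = fullv)%VS.
Proof.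
move=> full; have [[_ [g fullg]] _] := extA.
pose M t := (linfun (Sym_subst (torus t)) @: (act g @: U))%VS.
have limM v : is_limit (fun t => translates_sum act hs (M t) + Z)%VS 0 v.
  suff : limit_incl (fun t => translates_sum act hs (M t) + Z)%VS 0 fullv.
    by apply; apply: memvf.
  rewrite -full; apply: limit_incl_add => [|z zZ]; last first.
    by apply: limit_const => t; apply: subvP (addvSr _ _) _ zZ.
  rewrite /translates_sum big_seq; apply: limit_incl_sum => h hh.
  move=> _ /memv_imgP[u uA ->].
  apply: (limit_sub (Y := fun t => act h @: M t)%VS) => [t _|].
    by apply: subv_trans (addvSl _ _); rewrite (big_rem h hh) addvSl.
  exact: limit_map (torus_limit fullg uA).
have [p p0 pP] := full_limit_generic limM.
have /closed_nonrootP[t] : p * 'X != 0 by rewrite mulf_neq0 ?polyX_eq0.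
rewrite rootM negb_or rootX => /andP[/pP fullt /torus_unit].
move=> /subst_sub_action[l lW]; exists (l * g)%g.
apply/eqP; rewrite eqEsubv subvf -fullt addvS //.
by apply: translates_sumS; rewrite actionMV; apply: lW.
Qed.

(** If m' were in A, a transvection would move the span of the monomials outside
    A to a complement of the span of A with m' replaced by m. By degeneration a
    translate of U is then a complement too, against extremality, since m has
    larger weight than m'. *)
Lemma extremal_stable m m' (i j : 'I_n.+1) : (i < j)%N ->
  (expo m' + U_(j) = expo m + U_(i))%MM -> m \notin A -> m' \notin A.
Proof.
move=> lt_ij m'E mA; apply/negP => m'A.
have ij : i != j by rewrite neq_ltn lt_ij.
suff /(extremal_swap mA m'A) : exists g, (act g @: U + mono F (m |: A :\ m') = fullv)%VS.
  by have := weight_exchange lt_ij m'E; lia.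
set B := m |: A :\ m'.
pose M s := (linfun (Sym_subst (transvection i j s)) @: mono F (~: A) + mono F B)%VS.
have mj : (0 < expo m j)%N.
  have /mnmP/(_ j) := m'E; rewrite !mnmDE !mnm1E eqxx (negPf ij) addn0 => <-.
  by rewrite addn1.
have limB p : p \in B -> is_limit M 0 (monomial_vec F p).
  by move=> pB; apply: limit_const => s; apply: subvP (addvSr _ _) _ (mem_mono _ pB).
have limM p : is_limit M 0 (monomial_vec F p).
  have [/limB //|pB] := boolP (p \in B).
  have [->|pm'] := eqVneq p m'.
    have [w [wE w0 /(_ m' m'E) w1]] := transvection_monomial F m ij.
    have mj0 : (expo m j)%:R != 0 :> F by rewrite pnatr_eq0 -lt0n.
    pose f (s : F) := (expo m j)%:R^-1 *: \sum_(l < expo m j) s ^+ l *: w l.+1.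
    (* Modulo m, which B contains, f is the transvection of m divided by
       (expo m j) s. *)
    exists f; split=> [||s s0].
    - by apply: curve_scale; apply: curve_sum => l _; apply: curve_monomial.
    - rewrite /f -(prednK mj) big_ord_recl big1 => [|l _]; last first.
        by rewrite expr0n scale0r.
      by rewrite expr0 scale1r addr0 w1 scalerA prednK // mulVf ?scale1r.
    - suff -> : f s = (expo m j)%:R^-1 *: (s^-1 *:
          (Sym_subst (transvection i j s) (monomial_vec F m) - monomial_vec F m)).
        rewrite memvZ // memvZ // memvB //.
          apply: (subvP (addvSl _ _)); rewrite -lfunE memv_img //.
          by rewrite mem_mono ?inE.
        by apply: (subvP (addvSr _ _)); rewrite mem_mono ?setU11.
      rewrite wE big_ord_recl w0 expr0 scale1r addrAC subrr add0r /f.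
      congr (_ *: _); rewrite scaler_sumr; apply: eq_bigr => l _.
      by rewrite scalerA exprS mulKf.
  have pA : p \in ~: A.
    by move: pB; rewrite !inE pm' negb_or => /andP[].
  have [w [wE w0 _]] := transvection_monomial F p ij.
  exists (fun s => Sym_subst (transvection i j s) (monomial_vec F p)).
  split=> [||s s0].
  - apply: (curve_eq (g := fun s => \sum_(l < (expo p j).+1) s ^+ l *: w l)) => //.
    by apply: curve_sum => l _; apply: curve_monomial.
  - rewrite wE big_ord_recl big1 => [|l _]; last by rewrite expr0n scale0r.
    by rewrite expr0 scale1r addr0 w0.
  - by apply: (subvP (addvSl _ _)); rewrite -lfunE memv_img // mem_mono.
have limV v : is_limit M 0 v.
  by rewrite [v]Sym_expand; apply: limit_sum => p _; apply: limit_scale.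
have [p p0 pP] := full_limit_generic limV.
have /closed_nonrootP[s /pP fulls] := p0.
have [h hW] := subst_sub_action (transvection_unit s ij).
have [|g fullg] := @degeneration [:: h] (mono F B).
  apply/eqP; rewrite eqEsubv subvf -fulls addvS //.
  by rewrite /translates_sum big_seq1.
exists (h * g)%g; move: fullg; rewrite /translates_sum big_seq1.
by rewrite actionMV.
Qed.

End Extremal.
End Degeneration.

(** * Rotations of ternary monomials *)

Section Permutations.
Variables n k : nat.
Implicit Types (m : monomial n k) (s : 'S_n.+1).

Fact permute_subproof s m : exists m', forall i, expo m' i = expo m (s i).
Proof.
have [|m' m'E] := @monomial_of n k [multinom expo m (s i) | i < n.+1].
  rewrite mdegE -[RHS](sum_expo m) [RHS](reindex_inj (@perm_inj _ s)).
  by apply: eq_bigr => i _; rewrite mnmE.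
by exists m' => i; rewrite m'E mnmE.
Qed.

Definition permute s m : monomial n k := sval (cid (permute_subproof s m)).

Lemma permuteE s m i : expo (permute s m) i = expo m (s i).
Proof. by rewrite /permute; case: cid. Qed.

Lemma permute_inj s : injective (permute s).
Proof.
move=> m m' /(congr1 (@expo n k))/mnmP e; apply/expo_inj/mnmP => i.
by have := e (s^-1 i)%g; rewrite !permuteE permKV.
Qed.

End Permutations.

Section Plane.
Variable k : nat.
Implicit Types (m : monomial 2 k) (A : {set monomial 2 k}).

Let x1 : 'I_3 := @Ordinal 3 1 isT.
Let x2 : 'I_3 := @Ordinal 3 2 isT.

Lemma sum_ord3 (f : 'I_3 -> nat) : (\sum_(i < 3) f i = f ord0 + f x1 + f x2)%N.
Proof.
rewrite !big_ord_recr big_ord0 /= add0n.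
by congr (f _ + f _ + f _)%N; apply: val_inj.
Qed.

(** Exchanges move a unit of exponent to an earlier variable; m' is reached from
    m by first lowering the last exponent, then raising the first. *)
Lemma dominance A :
  (forall m m' (i j : 'I_3), (i < j)%N ->
     (expo m' + U_(j) = expo m + U_(i))%MM -> m \notin A -> m' \notin A) ->
  forall m m', (expo m ord0 <= expo m' ord0)%N -> (expo m' x2 <= expo m x2)%N ->
    m \notin A -> m' \notin A.
Proof.
move=> stable m m'.
have [d] := ubnP ((expo m' ord0 - expo m ord0) + (expo m x2 - expo m' x2)).
elim: d m => // d IH m ltd le0 le2 mA.
have := sum_expo m; have := sum_expo m'; rewrite !sum_ord3 => sum_m' sum_m.
have step (i j : 'I_3) : (i < j)%N -> (0 < expo m j)%N -> exists2 m1, m1 \notin A &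
    forall l, (expo m1 l + (j == l) = expo m l + (i == l))%N.
  move=> ij mj; have [m1 m1E] := exchange_exists i mj.
  exists m1 => [|l]; first exact: stable ij m1E mA.
  by have /mnmP/(_ l) := m1E; rewrite !mnmDE !mnm1E.
have [lt2|ge2] := ltnP (expo m' x2) (expo m x2).
  have [m1 m1A m1E] := step x1 x2 isT (leq_ltn_trans (leq0n _) lt2).
  have := m1E ord0; have := m1E x2; rewrite /= => e2 e0.
  by apply: (IH m1) => //; lia.
have [lt0|ge0] := ltnP (expo m ord0) (expo m' ord0).
  have mx1 : (0 < expo m x1)%N by lia.
  have [m1 m1A m1E] := step ord0 x1 isT mx1.
  have := m1E ord0; have := m1E x2; rewrite /= => e2 e0.
  by apply: (IH m1) => //; lia.
suff -> : m' = m by [].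
apply/expo_inj/mnmP => i.
have : i \in [:: ord0; x1; x2] by rewrite !inE; case: i => [[|[|[|]]]].
by rewrite !inE => /or3P[] /eqP ->; lia.
Qed.

Definition rotation (l : 'I_3) : 'S_3 := perm (addrI l).

Lemma rotationE l m i : expo (permute (rotation l) m) i = expo m (l + i).
Proof. by rewrite permuteE permE. Qed.

Lemma rotationK l m : permute (rotation l) (permute (rotation (- l)) m) = m.
Proof. by apply/expo_inj/mnmP => i; rewrite !rotationE addrA addNr add0r. Qed.

Lemma rotation_ends (P : nat -> nat -> bool) m :
  [|| P (expo m ord0) (expo m x2), P (expo m x1) (expo m ord0)
    | P (expo m x2) (expo m x1)] ->
  exists l, P (expo (permute (rotation l) m) ord0) (expo (permute (rotation l) m) x2).
Proof.
have e10 : x1 + x2 = ord0 by apply: val_inj.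
have e21 : x2 + x2 = x1 by apply: val_inj.
case/or3P => Pm; [exists ord0 | exists x1 | exists x2];
  by rewrite !rotationE ?e10 ?e21 ?add0r ?addr0.
Qed.

Definition rising : {set monomial 2 k} :=
  [set m | (3 * expo m ord0 <= k)%N && (k <= 3 * expo m x2)%N].

Definition falling : {set monomial 2 k} :=
  [set m | (k <= 3 * expo m ord0)%N && (3 * expo m x2 <= k)%N].

Lemma rotation_rising m : exists l, permute (rotation l) m \in rising.
Proof.
have [|l lP] := @rotation_ends (fun a c => (3 * a <= k)%N && (k <= 3 * c)%N) m.
  by have := sum_expo m; rewrite sum_ord3; lia.
by exists l; rewrite inE.
Qed.

Lemma rotation_falling m : exists l, permute (rotation l) m \in falling.
Proof.
have [|l lP] := @rotation_ends (fun a c => (k <= 3 * a)%N && (3 * c <= k)%N) m.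
  by have := sum_expo m; rewrite sum_ord3; lia.
by exists l; rewrite inE.
Qed.

(** Among three exponents with mean k / 3 read cyclically, an exponent at most
    the mean follows one at least the mean; so the rotations of the rising
    monomials exhaust all monomials. *)
Lemma card_rising : (#|monomial 2 k| <= 3 * #|rising|)%N.
Proof.
pose occurs m l := permute (rotation l) m \in rising.
have le_m m : (1 <= \sum_l occurs m l)%N.
  by have [l ml] := rotation_rising m; rewrite (bigD1 l) //= /occurs ml.
have le : (#|monomial 2 k| <= \sum_m \sum_l occurs m l)%N.
  by rewrite -sum1_card; apply: leq_sum.
apply: leq_trans le _; rewrite exchange_big /=.
have card_l (l : 'I_3) : (\sum_m occurs m l)%N = #|rising|.
  rewrite -(card_preimset rising (@permute_inj 2 k (rotation l))) -sum1_card.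
  by rewrite [RHS]big_mkcond; apply: eq_bigr => m _; rewrite /occurs !inE; case: (_ && _).
by rewrite (eq_bigr _ (fun l _ => card_l l)) sum_nat_const card_ord.
Qed.

(** Since A is too small to contain every rising monomial, one of them lies
    outside A, and every falling monomial dominates it. *)
Lemma falling_avoids A : (3 * #|A| < #|monomial 2 k|)%N ->
  (forall m m' (i j : 'I_3), (i < j)%N ->
     (expo m' + U_(j) = expo m + U_(i))%MM -> m \notin A -> m' \notin A) ->
  {in falling, forall m, m \notin A}.
Proof.
move=> cardA stable m; rewrite inE => /andP[m0 m2].
have /subsetPn[q] : ~~ (rising \subset A).
  apply/negP => /subset_leq_card; have := card_rising; lia.
rewrite inE => /andP[q0 q2] qA.
by apply: (dominance stable (m := q)) => //; lia.
Qed.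

End Plane.

(** * The diameter *)

Section Ternary.
Variables (F : numClosedFieldType) (k : nat).
Notation V := (Sym F 2 k).
Notation act := (Sym_action F 2 k).
Implicit Type U : {vspace V}.

(** The monomials outside an extremal complement include the falling ones, whose
    three rotations exhaust all monomials. *)
Lemma three_translates U : (3 * (\dim {:V} - \dim U) < \dim {:V})%N ->
  exists2 hs, size hs = 3%N & translates_sum act hs U = fullv.
Proof.
move=> large; have [A extA] := exists_extremal_complement U.
have [[cardA _] _] := extA.
have avoid : {in falling k, forall m, m \notin A}.
  apply: falling_avoids; last exact: extremal_stable extA.
  by have := dim_Sym_le F 2 k; lia.
have [h hP] := choice (fun l => subst_sub_action k (unitmx_perm F (rotation l))).
have full : (translates_sum act [seq h l | l <- enum 'I_3] (mono F (~: A)) + 0 =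
    fullv)%VS.
  rewrite addv0; apply: full_monomials => m; have [l ml] := rotation_falling m.
  rewrite /translates_sum big_map big_enum /= memvE (sumv_sup (- l)) // -memvE.
  apply: (subvP (hP _ _)); set m1 := permute (rotation l) m in ml.
  have <- : Sym_subst (perm_mx (rotation (- l))) (monomial_vec F m1) = monomial_vec F m.
    by apply: perm_monomial => i; rewrite -[in LHS](rotationK (- l) m) opprK permuteE.
  by rewrite -lfunE memv_img // mem_mono // inE avoid.
have [g fullg] := degeneration extA full.
exists [seq (h' * g)%g | h' <- [seq h l | l <- enum 'I_3]].
  by rewrite 2!size_map size_enum_ord.
rewrite addv0 in fullg; rewrite -fullg /translates_sum [LHS]big_map.
by apply: eq_bigr => h' _; rewrite actionMV.
Qed.

Lemma diameter_bound U : U <> 0%VS ->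
  exists2 m, is_group_additive_diameter act U m &
    (m * \dim U <= 6 * \dim {:V} + 3 * \dim U)%N.
Proof.
move=> /eqP; rewrite -dimv_eq0 -lt0n => U0.
pose N : nat := \dim {:V}; pose d : nat := \dim U; rewrite -/N -/d in U0 *.
(* With more than 2 N / d translates either alternative of translates_large
   leaves less than N / 3 missing. *)
have [gs [sizegs gsP]] := translates_large U (2 * N %/ d).+1
  (@Sym_irreducible F 2 k) (@Sym_connected F 2 k).
have large : (3 * (N - \dim (translates_sum act gs U)) < N)%N.
  case: gsP => // le; have := ltn_ceil (2 * N) U0; rewrite mulnC -/d in le *.
  have := dimvS (subvf (translates_sum act gs U)); rewrite -/N.
  lia.
have [hs sizehs full] := three_translates large.
have cover : covered_by_translates act U (3 * (2 * N %/ d).+1).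
  have <- : size [seq (h * g)%g | h <- hs, g <- gs] = (3 * (2 * N %/ d).+1)%N.
    by rewrite size_allpairs sizehs sizegs.
  by apply: covered_by_seq; rewrite translates_sum_allpairs.
pose P m := `[< covered_by_translates act U m >].
have exP : exists m, P m by eexists; apply/asboolP; apply: cover.
have [m /asboolP Pm minm] := ex_minnP exP.
exists m; first by split=> // m' Pm'; apply: minm; apply/asboolP.
have le_m : (m <= 3 * (2 * N %/ d).+1)%N by apply: minm; apply/asboolP.
have := leq_trunc_div (2 * N) d; nia.
Qed.

End Ternary.

(** * The covering complexity *)

Lemma count_lt_in (s : seq rat) (x y : rat) :
  x < y -> (count (< x) s + (x \in s) <= count (< y) s)%N.
Proof.
move=> xy; elim: s => //= z s IH; rewrite inE.
have [zx|xz|->] := ltgtP z x; last by rewrite xy /=; lia.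
  by rewrite (lt_trans zx xy) /=; lia.
by rewrite /= ?add0n; lia.
Qed.

(** The number of elements of s below r is maximized; by count_lt_in it increases
    strictly from one element of s to a larger one. *)
Lemma exists_max_rat (P : rat -> Prop) (s : seq rat) (r0 : rat) :
  P r0 -> (forall r, P r -> r \in s) -> exists2 r, P r & forall r', P r' -> r' <= r.
Proof.
move=> Pr0 Ps.
have [|[r Pr] max_r] := @exists_maximum {r | P r} (fun r => count (< sval r) s)
    (size s) (exist _ r0 Pr0).
  by move=> r; apply: count_size.
exists r => // r' Pr'; rewrite leNgt; apply/negP => /(count_lt_in s).
by have := max_r (exist _ r' Pr'); rewrite /= Ps //; lia.
Qed.

Section CoveringRatio.
Variables (F : numClosedFieldType) (k : nat).
Notation V := (Sym F 2 k).
Notation act := (Sym_action F 2 k).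

Lemma covering_ratio_le9 (U : {vspace V}) (r : rat) :
  U <> 0%VS -> is_covering_ratio act U r ->
  exists m c : nat, [/\ r = m%:R / c%:R, (0 < c)%N, (c <= \dim {:V})%N & (m <= 9 * c)%N].
Proof.
move=> U0 [m [_ min_m] ->]; have [m' [cov _] le_m'] := diameter_bound U0.
have le_mm' := min_m m' cov.
move: U0 => /eqP; rewrite -dimv_eq0 -lt0n => U0.
have dU := dimvS (subvf U).
pose N : nat := \dim {:V}; pose d : nat := \dim U; rewrite -/N -/d in U0 dU le_m' *.
set x : rat := N%:R / d%:R.
have d0 : 0 < d%:R :> rat by rewrite ltr0n.
have x1 : 1 <= x by rewrite ler_pdivlMr // mul1r ler_nat.
have c1 : (1 <= Num.ceil x)%R by rewrite -gtz0_ge1 ceil_gt0 (lt_le_trans _ x1).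
have cE : Num.ceil x = `|Num.ceil x|%N :> int by rewrite gez0_abs // (le_trans _ c1).
exists m, `|Num.ceil x|%N; rewrite {1}cE; split=> //; first by lia.
  rewrite -lez_nat -cE ceil_le_int ler_pdivrMr // -natrM ler_nat.
  by rewrite leq_pmulr.
have : (N <= `|Num.ceil x| * d)%N.
  rewrite -(ler_nat rat) natrM -ler_pdivrMr // -/x.
  by rewrite -[_%:R]/(`|Num.ceil x|%N%:~R) -cE ceil_ge.
have c0 : (0 < `|Num.ceil x|)%N by lia.
move=> leN; rewrite -(leq_pmul2r U0); nia.
Qed.

(** The covering ratios are fractions with bounded numerator and denominator, so
    finitely many, and the largest is attained. *)
Lemma covering_complexity_le9 : exists2 c, is_covering_complexity act c & c <= 9.
Proof.
pose P r := exists2 U, U <> 0%VS & is_covering_ratio act U r.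
have Ple r : P r -> exists m c : nat, [/\ r = m%:R / c%:R, (0 < c)%N,
    (c <= \dim {:V})%N & (m <= 9 * c)%N].
  by move=> [U U0 /(covering_ratio_le9 U0)].
pose s : seq rat := [seq m%:R / c%:R | m <- iota 0 (9 * \dim {:V}).+1,
                                       c <- iota 0 (\dim {:V}).+1].
have Ps r : P r -> r \in s.
  move=> /Ple[m [c [-> c0 cN mc]]]; apply/allpairsP; exists (m, c).
  by split=> //; rewrite mem_iota /=; lia.
have [m diam_m _] := diameter_bound (@Sym_neq0 F 2 k).
have [r0 Pr0] : exists r, P r.
  by eexists; exists fullv; [exact: Sym_neq0 | exists m].
have [r [U U0 rU] max_r] := exists_max_rat Pr0 Ps.
exists r.
  split; [exact: Sym_irreducible | by exists U |].
  by move=> W r' W0 rW; apply: max_r; exists W.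
have [m' [c [-> c0 _ le9]]] := covering_ratio_le9 U0 rU.
by rewrite ler_pdivrMr ?ltr0n // -natrM ler_nat.
Qed.

End CoveringRatio.

(** From ln x <= x - 1 at x = 1/3. *)
Lemma ln3_ge (R : realType) : 2 / 3 <= exp.ln (3 : R).
Proof.
have /exp.le_ln1Dx : -1 < - (2 / 3) :> R by lra.
have -> : 1 - 2 / 3 = 3^-1 :> R by field.
by rewrite exp.lnV ?posrE //; lra.
Qed.

Theorem theorem7p6 (R : realType) (k : nat) (hk : (1 <= k)%N) :
  (forall U : {vspace Sym (complex R) 2 k}, U <> 0%VS ->
     exists2 m : nat,
       is_group_additive_diameter (Sym_action (complex R) 2 k) U m &
       m%:R <= 9 * exp.ln (3 : R)
               * ((\dim {: Sym (complex R) 2 k})%:R / (\dim U)%:R) + 9) /\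
  (exists2 c : rat,
     is_covering_complexity (Sym_action (complex R) 2 k) c & c < 16).
Proof.
split=> [U U0|]; last first.
  have [c cC c9] := @covering_complexity_le9 (complex R) k.
  by exists c => //; apply: le_lt_trans c9 _.
have [m diam_m le_m] := diameter_bound U0.
exists m => //.
have {}U0 : 0 < (\dim U)%:R :> R.
  by rewrite ltr0n lt0n dimv_eq0; apply/eqP.
set N := (\dim {: Sym (complex R) 2 k})%:R : R; set d := (\dim U)%:R in U0 *.
have {}le_m : m%:R * d <= 6 * N + 3 * d by rewrite -!natrM -natrD ler_nat.
have {le_m} : m%:R <= 6 * (N / d) + 3.
  by rewrite -(ler_pM2r U0) mulrDl -mulrA divfK ?gt_eqF.
have : 0 <= N / d by rewrite divr_ge0 // ler0n.
have := ln3_ge R; nra.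
Qed.
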